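(* Let $\mathcal M$ be a smooth manifold, let $g=(g^1,\dots,g^m)\colon\mathcal M\to\mathbb R^m$ and $h=(h^1,\dots,h^q)\colon\mathcal M\to\mathbb R^q$ be of class $C^1$, let $\Omega=\{p\in\mathcal M: g(p)\le 0,\ h(p)=0\}$ and let $p\in\Omega$. If the Mangasarian--Fromovitz constraint qualification (MFCQ) holds at $p$, then the Abadie constraint qualification (ACQ) holds at $p$, i.e. $\mathcal L(\Omega;p)=\mathcal T(\Omega;p)$.
   Context: A smooth manifold is a Hausdorff, second-countable space with a smooth ($C^\infty$) atlas of dimension $n$. Tangent vectors at $p$ are those generated by $C^1$-curves $\gamma\colon(-\varepsilon,\varepsilon)\to\mathcal M$ with $\gamma(0)=p$; such a curve generates $[\dot\gamma(0)]$, acting on $C^1$-functions $s$ defined near $p$ by $[\dot\gamma(0)](s)=\frac{\mathrm d}{\mathrm dt}(s\circ\gamma)|_{t=0}$. They form the $n$-dimensional tangent space $\mathcal T_p\mathcal M$; the differential of $s$ at $p$ is $(\mathrm ds)(p)\,\xi=\xi(s)$. The active set is $\mathcal A(p)=\{i\in\{1,\dots,m\}: g^i(p)=0\}$. MFCQ holds at $p$ if $\{(\mathrm dh^j)(p)\}_{j=1}^q$ is linearly independent (as a family) in the dual $\mathcal T_p^*\mathcal M$ and there exists $\xi\in\mathcal T_p\mathcal M$ with $(\mathrm dg^i)(p)\,\xi<0$ for all $i\in\mathcal A(p)$ and $(\mathrm dh^j)(p)\,\xi=0$ for all $j=1,\dots,q$. (Bouligand) tangent cone: $\mathcal T(\Omega;p)$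 is the set of all $\xi\in\mathcal T_p\mathcal M$ for which there exist sequences $(p_k)\subseteq\Omega$ and $t_k\searrow 0$ (with $t_k>0$) such that for all $C^1$-functions $s$ defined near $p$, $\xi(s)=\lim_{k\to\infty}\frac{s(p_k)-s(p)}{t_k}$ (in particular $p_k\to p$, so that $s(p_k)$ is defined for large $k$). Linearizing cone: $\mathcal L(\Omega;p)=\{\xi\in\mathcal T_p\mathcal M:\ \xi(g^i)\le 0\ \forall i\in\mathcal A(p),\ \xi(h^j)=0\ \forall j=1,\dots,q\}$. *)

(* Defs.v *)
From mathcomp Require Import all_boot all_order all_algebra.
From mathcomp Require Import all_classical all_reals all_analysis.
Import Order.TTheory GRing.Theory Num.Theory.
Import numFieldNormedType.Exports.

Set Implicit Arguments.
Unset Strict Implicit.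
Unset Printing Implicit Defensive.

Local Open Scope classical_set_scope.
Local Open Scope ring_scope.

Section Ck.
Context {R : realType} {V W : normedModType R}.

(* [f] is of class C^k on [A].  Meant for [A] open and [V] finite-dimensional:
   continuity of [x |-> 'D_v f x] for each fixed [v] is then continuity of the
   differential, and continuity at the points of [A] is continuity on [A]. *)
Fixpoint Ck (k : nat) (A : set V) (f : V -> W) : Prop :=
  if k is k'.+1
  then (forall x, A x -> differentiable f x) /\
       (forall v, Ck k' A (fun x => 'D_v f x))
  else forall x, A x -> {for x, continuous f}.

Definition Cinfty (A : set V) (f : V -> W) : Prop := forall k, Ck k A f.

End Ck.

(* A homeomorphism from the open set [dom] onto the open set [cod].  Both maps
   are total, with irrelevant values outside [dom] and [cod]. *)
Record chart (R : realType) (n : nat) (M : topologicalType) := Chart {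
  dom : set M;
  cod : set 'rV[R]_n;
  coords : M -> 'rV[R]_n;
  param : 'rV[R]_n -> M;
  open_dom : open dom;
  open_cod : open cod;
  coords_cod : forall x, dom x -> cod (coords x);
  param_dom : forall y, cod y -> dom (param y);
  coordsK : forall x, dom x -> param (coords x) = x;
  paramK : forall y, cod y -> coords (param y) = y;
  coords_continuous : forall x, dom x -> {for x, continuous coords};
  param_continuous : forall y, cod y -> {for y, continuous param} }.

Record smooth_manifold (R : realType) (n : nat) := SmoothManifold {
  carrier :> topologicalType;
  carrier_hausdorff : hausdorff_space carrier;
  carrier_second_countable : @second_countable carrier;
  atlas : set (chart R n carrier);
  atlas_cover : forall x : carrier, exists2 c, atlas c & dom c x;
  atlas_smooth : forall c d, atlas c -> atlas d ->
    Cinfty (coords c @` (dom c `&` dom d)) (coords d \o param c) }.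

Section TangentSpace.
Context {R : realType} {n : nat} (M : smooth_manifold R n).

Definition C1_on (W : normedModType R) (O : set M) (f : M -> W) : Prop :=
  forall c, atlas c -> Ck 1 (coords c @` (dom c `&` O)) (f \o param c).

Record C1_map (W : normedModType R) := C1Map {
  C1_map_fun :> M -> W;
  C1_mapP : C1_on [set: M] C1_map_fun }.

(* C^1 functions defined near [p]: total functions required to be C^1 on some
   open neighbourhood of [p], whose values away from [p] are irrelevant. *)
Record C1_near (p : M) := C1Near {
  C1_near_fun :> M -> R;
  C1_nearP : exists2 O : set M, open_nbhs p O & C1_on O C1_near_fun }.

Definition C1_curve (e : R) (gamma : R -> M) : Prop :=
  (forall t : R, - e < t < e -> {for t, continuous gamma}) /\
  (forall c, atlas c ->
    Ck 1 ([set t : R | - e < t < e] `&` gamma @^-1` dom c) (coords c \o gamma)).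

Definition velocity (p : M) (gamma : R -> M) : C1_near p -> R :=
  fun s => derive1 (s \o gamma) 0.

Record tangent (p : M) := Tangent {
  tangent_fun :> C1_near p -> R;
  tangentP : exists (e : R) (gamma : R -> M),
    [/\ 0 < e, C1_curve e gamma, gamma 0 = p & tangent_fun = velocity gamma] }.

Definition differential (p : M) (s : C1_near p) : tangent p -> R :=
  fun xi => xi s.

Lemma C1_near_coord m (f : C1_map 'rV[R]_m) (i : 'I_m) (p : M) :
  exists2 O : set M, open_nbhs p O & C1_on O (fun x => f x 0 i).
Proof.
exists [set: M]; first by split => //; exact: openT.
move=> c /(C1_mapP f) [df cf]; split=> [x Ax|v x Ax] /=.
  exact: (differentiable_comp (df x Ax) (differentiable_coord _ _ _)).
have Dcoord y : (coords c @` (dom c `&` setT)) y ->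
    'D_v ((fun z => f z 0 i) \o param c) y = ('D_v (f \o param c) y) 0 i.
  by move=> Ay; rewrite derive_mx ?mxE//; exact: diff_derivable (df y Ay).
have oA : open (coords c @` (dom c `&` [set: M])).
  have -> : coords c @` (dom c `&` [set: M]) = cod c.
    apply/seteqP; split=> [_ [z [dz _] <-]|y cy]; first exact: coords_cod.
    exists (param c y); last exact: paramK.
    by split=> //; exact: param_dom.
  exact: open_cod.
have nA : \forall y \near x,
    ('D_v (f \o param c) y) 0 i = 'D_v ((fun z => f z 0 i) \o param c) y.
  by apply: filterS (open_nbhs_nbhs (conj oA Ax)) => y /Dcoord.
change ((fun y => 'D_v ((fun z => f z 0 i) \o param c) y) @ x -->
  'D_v ((fun z => f z 0 i) \o param c) x).
rewrite (Dcoord x Ax); apply: cvg_trans (near_eq_cvg nA) _.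
exact: (continuous_comp (cf v x Ax) (@coord_continuous _ _ _ 0 i _)).
Qed.

(* The component [f^i] of [f = (f^1, ..., f^m)], as a function near [p]. *)
Definition comp_near m (f : C1_map 'rV[R]_m) (i : 'I_m) (p : M) : C1_near p :=
  C1Near (C1_near_coord f i p).

End TangentSpace.

Definition linearly_independent (R : realType) (V : lmodType R) (q : nat)
    (v : 'I_q -> V) : Prop :=
  forall a : 'I_q -> R, \sum_(j < q) a j *: v j = 0 -> forall j, a j = 0.

Section ConstraintQualifications.
Context {R : realType} {n m q : nat} {M : smooth_manifold R n}.
Variables (g : C1_map M 'rV[R]_m) (h : C1_map M 'rV[R]_q).

Definition feasible_set : set M :=
  [set x | (forall i, g x 0 i <= 0) /\ h x = 0].

Definition active_set (p : M) : set 'I_m := [set i | g p 0 i = 0].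

(* Independence is stated in the space of all real functions on the tangent
   space, of which the cotangent space is a subspace. *)
Definition MFCQ (p : M) : Prop :=
  linearly_independent (fun j => differential (comp_near h j p)) /\
  exists xi : tangent p,
    (forall i, active_set p i -> differential (comp_near g i p) xi < 0) /\
    (forall j, differential (comp_near h j p) xi = 0).

Definition tangent_cone (Omega : set M) (p : M) : set (tangent p) :=
  [set xi | exists (pk : nat -> M) (t : nat -> R),
    [/\ forall k, Omega (pk k),
        pk @ \oo --> p,
        (forall k, 0 < t k) /\ nonincreasing_seq t,
        t @ \oo --> 0 &
        forall s : C1_near p,
          (s (pk k) - s p) / t k @[k --> \oo] --> xi s]].

Definition linearizing_cone (p : M) : set (tangent p) :=
  [set xi | (forall i, active_set p i -> xi (comp_near g i p) <= 0) /\
            (forall j, xi (comp_near h j p) = 0)].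

Definition ACQ (p : M) : Prop :=
  @linearizing_cone p = @tangent_cone feasible_set p.

End ConstraintQualifications.

(* Main.v *)
(* In a chart around p, a tangent vector becomes a vector v of R^n acting on
   functions by their differential at x0.  The inclusion of the tangent cone in
   the linearizing cone is a passage to the limit in the difference quotients.
   Conversely, perturb a linearized direction v to w = v + s v0 with v0 the
   MFCQ direction and s > 0 small: w is tangent to {h = 0} by Lyusternik's
   theorem (the differential of h is onto), and since the active g^i decrease
   strictly along w, the points of {h = 0} realizing w are eventually feasible.
   Hence w is tangent to the feasible set, and so is v since the tangent
   directions form a closed set. *)
From HB Require Import structures.
Require Import Defs.
From mathcomp Require Import all_boot all_order all_algebra.
From mathcomp Require Import all_classical all_reals all_analysis.
From mathcomp Require Import lra.
Import Order.TTheory GRing.Theory Num.Theory.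
Import numFieldNormedType.Exports.
Set Implicit Arguments.
Unset Strict Implicit.
Unset Printing Implicit Defensive.
Local Open Scope classical_set_scope.
Local Open Scope ring_scope.

(** * Entrywise norm estimates and one-sided inverses of matrices *)

Lemma ler_mx_coord (R : realType) (m n : nat) (A : 'M[R]_(m, n)) i j :
  `|A i j| <= `|A|.
Proof. by rewrite [leRHS]/Num.Def.normr/= mx_normrE (le_bigmax _ _ (i, j)). Qed.

Lemma ler_mx_norm (R : realType) (m n : nat) (A : 'M[R]_(m, n)) (c : R) :
  0 <= c -> (forall i j, `|A i j| <= c) -> `|A| <= c.
Proof.
by move=> c0 Ac; rewrite [leLHS]/Num.Def.normr/= mx_normrE bigmax_le.
Qed.

Lemma ler_norm_mulmx (R : realType) (n q : nat) (x : 'rV[R]_n)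
    (B : 'M[R]_(n, q)) (c : R) :
  0 <= c -> (forall i j, `|B i j| <= c) -> `|x *m B| <= n%:R * c * `|x|.
Proof.
move=> c0 Bc; apply: ler_mx_norm => [|i j]; first by rewrite !mulr_ge0.
rewrite mxE (le_trans (ler_norm_sum _ _ _))//.
have -> : n%:R * c * `|x| = \sum_(k < n) c * `|x|.
  by rewrite sumr_const card_ord -mulrA mulr_natl.
by apply: ler_sum => k _; rewrite normrM mulrC ler_pM// ler_mx_coord.
Qed.

(** Injectivity on columns means rank [q]. As [J] acts on row vectors by [x *m J], the matrix [B] is
    a linear right inverse of that action: independence of differentials turns into surjectivity. *)
Lemma left_inverse_mx (F : fieldType) (n q : nat) (J : 'M[F]_(n, q)) :
  (forall a : 'cV_q, J *m a = 0 -> a = 0) -> exists B, B *m J = 1%:M.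
Proof.
move=> J_inj; apply/row_fullP.
rewrite /row_full -mxrank_tr -/(row_free _) -kermx_eq0.
apply/eqP/row_matrixP => i.
rewrite row0; apply: trmx_inj; rewrite trmx0; apply: J_inj; apply: trmx_inj.
by rewrite trmx_mul trmxK trmx0 -row_mul mulmx_ker row0.
Qed.

(** * Mean value theorem and strict differentiability *)

Lemma mean_value_coord (R : realType) (n q : nat) (f : 'rV[R]_n -> 'rV[R]_q)
    (x y : 'rV[R]_n) (i : 'I_q) :
  (forall t : R, 0 <= t <= 1 -> differentiable f (y + t *: (x - y))) ->
  exists2 t : R, 0 <= t <= 1 &
    (f x - f y) 0 i = ((x - y) *m 'J f (y + t *: (x - y))) 0 i.
Proof.
move=> df; set u := x - y; pose l t : 'rV[R]_n := y + t *: u.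
have dl (t : R) : is_diff t l (fun s => s *: u).
  have -> : (fun s => s *: u) = cst 0 + ( *:%R ^~ u) :> (R -> 'rV[R]_n).
    by apply/funext => s; rewrite fctE /= add0r.
  exact: is_diffD.
have dfl (t : R) : 0 <= t <= 1 ->
    is_diff t (f \o l) ('d f (l t) \o (fun s => s *: u)).
  move=> t01; apply: is_diff_comp => //; apply: differentiableP; exact: df.
pose psi t := f (l t) 0 i.
have dpsi (t : R) : 0 <= t <= 1 -> is_derive t 1 psi ((u *m 'J f (l t)) 0 i).
  move=> t01; have := dfl t t01 => dflt.
  have dflt' : derivable (f \o l) t 1 by apply: diff_derivable.
  apply: DeriveDef; first by have /derivable_mxP := dflt'; exact.
  have := derive_mx dflt' => /matrixP /(_ 0 i); rewrite [in RHS]mxE => <-.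
  by rewrite deriveE// diff_val /= scale1r -deriveE ?deriveEjacobian//;
    exact: df.
have [t t01 E] : exists2 t, t \in `[0, 1]%R &
    psi 1 - psi 0 = ((u *m 'J f (l t)) 0 i) * (1 - 0).
  apply: MVT_segment => //.
    by move=> t /[!in_itv]/= /andP[t0 t1]; apply: dpsi; rewrite !ltW.
  apply: derivable_within_continuous => t /[!in_itv]/= t01.
  by have [] := dpsi t t01.
exists t; first by move: t01; rewrite in_itv.
move: E; rewrite /psi /l scale1r scale0r addr0 subr0 mulr1.
rewrite (addrC y) subrK => <-.
by rewrite !mxE.
Qed.

(** Each coordinate of the remainder is, by the mean value theorem, a coordinate of [x - y] times
    ['J f z - 'J f x0] with [z] on the segment. Continuity of the partial derivatives makes that
    matrix small near [x0]. *)
Lemma Ck1_strict_diff (R : realType) (n q : nat) (A : set 'rV[R]_n)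
    (f : 'rV[R]_n -> 'rV[R]_q) (x0 : 'rV[R]_n) (e : R) :
  open A -> Ck 1 A f -> A x0 -> 0 < e ->
  exists2 d : R, 0 < d & forall x y, `|x - x0| < d -> `|y - x0| < d ->
    `|f x - f y - (x - y) *m 'J f x0| <= e * `|x - y|.
Proof.
(* Multiplying by a matrix with entries at most [c] costs a factor [n]; the successor keeps the
   division meaningful when [n = 0]. *)
move=> oA [df cDf] Ax0 e0; set c := e / n.+1%:R.
have c0 : 0 < c by rewrite divr_gt0.
have JE z i j : A z -> 'J f z i j = ('D_(delta_mx 0 i) f z) 0 j.
  by move=> Az; rewrite deriveEjacobian; [rewrite -rowE [RHS]mxE|exact: df].
have mxB (P Q : 'M[R]_(n, q)) i j : (P - Q) i j = P i j - Q i j by rewrite !mxE.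
have nJ : \forall z \near x0, forall ij : 'I_n * 'I_q,
    `|('J f z - 'J f x0) ij.1 ij.2| <= c.
  apply: (@filter_forall _ _ (fun (ij : 'I_n * 'I_q) (z : 'rV[R]_n) =>
    `|('J f z - 'J f x0) ij.1 ij.2| <= c) (nbhs x0)) => -[i j] /=.
  have cD : {for x0, continuous (fun z => ('D_(delta_mx 0 i) f z) 0 j)}.
    exact: (continuous_comp (cDf _ _ Ax0) (@coord_continuous _ _ _ 0 j _)).
  move/cvgrPdist_le : cD => /(_ _ c0) nc.
  have nA : \forall z \near x0, A z by exact: open_nbhs_nbhs.
  apply: filterS2 nA nc => z Az; rewrite distrC -(JE z)// -(JE x0)//.
  by rewrite mxB.
have : \forall z \near x0,
    A z /\ forall i j, `|('J f z - 'J f x0) i j| <= c.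
  have nA : \forall z \near x0, A z by exact: open_nbhs_nbhs.
  by apply: filterS2 nA nJ => z Az Jz; split=> // i j; exact: (Jz (i, j)).
move=> /nbhs_normP[d /= d0 dP]; exists d => // x y xd yd.
have seg (t : R) : 0 <= t <= 1 -> `|x0 - (y + t *: (x - y))| < d.
  move=> /andP[t0 t1]; rewrite distrC.
  have -> : y + t *: (x - y) - x0 = (1 - t) *: (y - x0) + t *: (x - x0).
    by rewrite scalerBl scale1r !scalerBr; apply/rowP => k; rewrite !mxE; lra.
  (* Strictness comes from the term with factor [1 - t], hence the separate case [t = 1]. *)
  have [->|tn1] := eqVneq t 1; first by rewrite subrr scale0r add0r scale1r.
  have t1' : 0 < 1 - t by rewrite subr_gt0 lt_neqAle tn1.
  apply: le_lt_trans (ler_normD _ _) _; rewrite !normrZ ger0_norm ?ltW//.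
  rewrite (ger0_norm t0).
  apply: (@lt_le_trans _ _ ((1 - t) * d + t * d)); last by lra.
  by apply: ltr_leD; [rewrite ltr_pM2l|rewrite ler_wpM2l// ltW].
apply: ler_mx_norm => [|a i]; first by rewrite mulr_ge0// ltW.
rewrite ord1 {a}.
have dseg (t : R) : 0 <= t <= 1 -> differentiable f (y + t *: (x - y)).
  by move=> t01; apply: df; have [] := dP _ (seg t t01).
have [t t01 E] := mean_value_coord i dseg.
have -> : (f x - f y - (x - y) *m 'J f x0) 0 i
    = ((x - y) *m ('J f (y + t *: (x - y)) - 'J f x0)) 0 i.
  by rewrite mulmxBr [LHS]mxE [RHS]mxE E.
apply: le_trans (ler_mx_coord _ _ _) _.
have [_ Jc] := dP _ (seg t t01).
apply: le_trans (ler_norm_mulmx _ (ltW c0) Jc) _.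
rewrite ler_wpM2r// /c mulrCA ler_piMr ?(ltW e0)// ler_pdivrMr// mul1r.
by rewrite ler_nat.
Qed.

(** * Fixed points and Lyusternik's theorem *)

Lemma half_contraction_fixpoint (R : realType) (q : nat) (U : set 'rV[R]_q)
    (F : 'rV[R]_q -> 'rV[R]_q) :
  closed U -> U !=set0 -> (forall y, U y -> U (F y)) ->
  (forall y y', U y -> U y' -> `|F y - F y'| <= 2^-1 * `|y - y'|) ->
  exists2 y, U y & F y = y.
Proof.
move=> Uc U0 UF FC.
pose V : completeNormedModType R :=
  HB.pack_for (completeNormedModType R) 'rV[R]_q
    (NormedModule.on 'rV[R]_q) (Complete.on 'rV[R]_q).
have half0 : 0 <= 2^-1 :> R by [].
have [|//||y Uy yF] := @banach_fixed_point R V U (mkfun_fun UF).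
- exists (NngNum half0); split => /=; first by lra.
  by move=> [y y'] [/= Uy Uy']; exact: FC.
- exact: U0.
- by exists y.
Qed.

(* Solutions of [f = 0] near [x0 + t *: w] are sought as
   [x0 + t *: w + y *m B], where [y] is a fixed point of a map which is
   1/2-Lipschitz because [B] inverts the derivative of [f] at [x0]. *)
Lemma lyusternik (R : realType) (n q : nat) (A : set 'rV[R]_n)
    (f : 'rV[R]_n -> 'rV[R]_q) (x0 w : 'rV[R]_n) (B : 'M[R]_(q, n)) (e : R) :
  open A -> Ck 1 A f -> A x0 -> f x0 = 0 ->
  B *m 'J f x0 = 1%:M -> w *m 'J f x0 = 0 -> 0 < e ->
  exists2 d : R, 0 < d & forall t, 0 < t < d ->
    exists2 x, f x = 0 & `|x - x0 - t *: w| <= t * e.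
Proof.
move=> oA fA Ax0 fx0 BJ wJ e0.
pose C := q%:R * `|B| + 1.
have C0 : 0 < C by rewrite ltr_wpDl// mulr_ge0.
have BC (y : 'rV_q) : `|y *m B| <= C * `|y|.
  apply: le_trans (ler_norm_mulmx y (normr_ge0 B) (ler_mx_coord B)) _.
  by rewrite ler_wpM2r// /C lerDl.
(* For [y] in the ball of radius [t * e1], the correction [y *m B] has norm at most [t * e], the
   allowed error. *)
pose e1 := e / C.
have e10 : 0 < e1 by rewrite divr_gt0.
have Ce1 : C * e1 = e by rewrite /e1 mulrC divfK ?gt_eqF.
have w10 : 0 < `|w| + 1 by rewrite ltr_wpDl.
(* The first bound makes [F] below 1/2-Lipschitz. The second puts [F 0] within half the radius
   [t * e1], so that [F] maps the ball [U] into itself. *)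
pose eps := Num.min (2^-1 / C) (e1 / 2 / (`|w| + 1)).
have eps0 : 0 < eps by rewrite lt_min !divr_gt0.
have epsC : eps * C <= 2^-1 by rewrite -ler_pdivlMr// ge_min lexx.
have epsw : eps * `|w| <= e1 / 2.
  apply: (@le_trans _ _ (eps * (`|w| + 1))).
    by rewrite ler_wpM2l ?(ltW eps0)// lerDl.
  by rewrite -ler_pdivlMr// ge_min lexx orbT.
have [d0 d00 sd] := Ck1_strict_diff oA fA Ax0 eps0.
have we0 : 0 < `|w| + e by rewrite ltr_wpDl.
exists (d0 / (`|w| + e)); first by rewrite divr_gt0.
move=> t /andP[t0]; rewrite ltr_pdivlMr// => td.
have te10 : 0 < t * e1 by rewrite mulr_gt0.
pose X (y : 'rV[R]_q) : 'rV[R]_n := x0 + t *: w + y *m B.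
have XB y y' : X y - X y' = (y - y') *m B.
  by rewrite /X opprD addrACA subrr add0r mulmxBl.
have X0 y : X y - x0 = t *: w + y *m B.
  by rewrite /X -(addrA x0) (addrC x0) addrK.
pose U : set 'rV[R]_q := closed_ball_ Num.norm 0 (t * e1).
have UE y : U y = (`|y| <= t * e1) :> Prop.
  by rewrite /U /closed_ball_ /= sub0r normrN.
have Xe y : U y -> `|y *m B| <= t * e.
  rewrite UE => Uy; apply: le_trans (BC y) _.
  by rewrite -Ce1 mulrCA ler_wpM2l// ltW.
have Xn y : U y -> `|X y - x0| < d0.
  move=> Uy; rewrite X0 (le_lt_trans (ler_normD _ _))//.
  apply: le_lt_trans td; rewrite normrZ gtr0_norm// mulrDr lerD2l.
  exact: Xe.
pose F y := y - f (X y).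
have FC y y' : U y -> U y' -> `|F y - F y'| <= 2^-1 * `|y - y'|.
  move=> Uy Uy'; have := sd _ _ (Xn _ Uy) (Xn _ Uy').
  (* The linear part of [f (X y) - f (X y')] is exactly [y - y'], so [F y - F y'] is, up to sign,
     the remainder. *)
  rewrite XB -mulmxA BJ mulmx1 => H.
  have -> : F y - F y' = - (f (X y) - f (X y') - (y - y')).
    by rewrite /F; apply/rowP => k; rewrite !mxE; lra.
  rewrite normrN; apply: le_trans H _.
  apply: (@le_trans _ _ (eps * (C * `|y - y'|))).
    by rewrite ler_wpM2l ?(ltW eps0).
  by rewrite mulrA ler_wpM2r.
have U0 : U 0 by rewrite UE normr0 ltW.
have F0 : `|F 0| <= t * e1 / 2.
  have x0d : `|x0 - x0| < d0 by rewrite subrr normr0.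
  have := sd _ _ (Xn 0 U0) x0d.
  rewrite X0 mul0mx addr0 -scalemxAl wJ scaler0 subr0 fx0 subr0 => H.
  rewrite /F sub0r normrN; apply: le_trans H _.
  by rewrite normrZ gtr0_norm// mulrCA -mulrA ler_wpM2l// ltW.
have [y Uy Fy] : exists2 y, U y & F y = y.
  apply: half_contraction_fixpoint => //.
  - exact: closed_closed_ball_.
  - by exists 0.
  - move=> y Uy; rewrite UE -[F y](subrK (F 0)) (le_trans (ler_normD _ _))//.
    rewrite [leRHS](splitr (t * e1)) lerD//.
    apply: le_trans (FC _ _ Uy U0) _; rewrite subr0 mulrC ler_wpM2r//.
    by rewrite -UE.
exists (X y); last by rewrite X0 addrAC subrr add0r; exact: Xe.
by move/eqP: Fy; rewrite /F subr_eq -subr_eq0 opprD addNKr oppr_eq0 => /eqP.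
Qed.

(** * Tangent directions and difference quotients in normed spaces *)

(** This is the Bouligand cone in a form without sequences: a single [e] bounds both the step [t]
    and the error relative to [t]. *)
Definition tangent_dir (R : realType) (V : normedModType R) (P : set V)
    (x0 v : V) : Prop :=
  forall e : R, 0 < e ->
    exists t x, [/\ 0 < t < e, P x & `|x - x0 - t *: v| <= t * e].

Lemma cvg_harmonic_bound (R : realType) (V : normedModType R) (u : nat -> V) l :
  (forall k, `|l - u k| <= harmonic k) -> u @ \oo --> l.
Proof.
move=> ul; apply/cvgrPdist_le => e e0.
have /cvgrPdist_le/(_ e e0) := @cvg_harmonic R; apply: filterS => k.
rewrite sub0r normrN ger0_norm ?harmonic_ge0//; exact: le_trans.
Qed.

Lemma tangent_dir_seq (R : realType) (V : normedModType R) (P : set V)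
    (x0 v : V) :
  tangent_dir P x0 v -> exists (x : nat -> V) (t : nat -> R),
    [/\ forall k, P (x k), forall k, 0 < t k, nonincreasing_seq t,
        t @ \oo --> 0 & (t k)^-1 *: (x k - x0) @[k --> \oo] --> v].
Proof.
move=> Pv.
have /choice[f fP] : forall e : R, exists p : R * V, 0 < e ->
    [/\ 0 < p.1 < e, P p.2 & `|p.2 - x0 - p.1 *: v| <= p.1 * e].
  move=> e; have [e0|e0] := ltP 0 e; last by exists (0, x0).
  by have [t [x ?]] := Pv e e0; exists (t, x).
(* The next tolerance is capped by the current step, which makes [t] nonincreasing, and by
   [harmonic], which sends both the steps and the errors of the quotients to 0. *)
pose fix e k := if k is k'.+1 then Num.min (f (e k')).1 (harmonic k) else 1.
have e0 k : 0 < e k.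
  elim: k => [|k IH]; first exact: ltr01.
  by rewrite [e _]/= lt_min harmonic_gt0 andbT; have [/andP[]] := fP _ IH.
have eh k : e k <= harmonic k.
  by case: k => [|k]; [rewrite /= invr1|rewrite [e _]/= ge_min lexx orbT].
pose x k := (f (e k)).2; pose t k := (f (e k)).1.
have t0 k : 0 < t k by have [/andP[]] := fP _ (e0 k).
have te k : t k < e k by have [/andP[]] := fP _ (e0 k).
exists x, t; split=> //.
- by move=> k; have [] := fP _ (e0 k).
- apply/nonincreasing_seqP => k; apply: le_trans (ltW (te k.+1)) _.
  by rewrite [e _]/= ge_min lexx.
- apply: cvg_harmonic_bound => k; rewrite sub0r normrN gtr0_norm//.
  exact: le_trans (ltW (te k)) (eh k).
- apply: cvg_harmonic_bound => k; apply: le_trans (eh k).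
  have -> : v - (t k)^-1 *: (x k - x0) = - ((t k)^-1 *: (x k - x0 - t k *: v)).
    by rewrite [in RHS]scalerBr scalerA mulVf ?gt_eqF// scale1r opprB.
  rewrite normrN normrZ gtr0_norm ?invr_gt0// ler_pdivrMl//.
  by have [] := fP _ (e0 k).
Qed.

Lemma tangent_dir_closed (R : realType) (V : normedModType R) (P : set V)
    (x0 v : V) :
  (forall e : R, 0 < e -> exists2 w, `|w - v| <= e & tangent_dir P x0 w) ->
  tangent_dir P x0 v.
Proof.
move=> vP e e0; have e20 : 0 < e / 2 by rewrite divr_gt0.
have [w wv /(_ _ e20)[t [x [/andP[t0 te] Px xw]]]] := vP _ e20.
exists t, x; split=> //; first by rewrite t0/=; lra.
have -> : x - x0 - t *: v = (x - x0 - t *: w) + t *: (w - v).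
  by rewrite scalerBr addrA subrK.
rewrite (splitr e) mulrDr (le_trans (ler_normD _ _))// lerD//.
by rewrite normrZ gtr0_norm// ler_wpM2l// ltW.
Qed.

Lemma diff_remainder (R : realType) (V W : normedModType R) (s : V -> W)
    (x0 : V) (e : R) : differentiable s x0 -> 0 < e ->
  \forall x \near x0, `|s x - s x0 - 'd s x0 (x - x0)| <= e * `|x - x0|.
Proof.
move=> /diffE ds e0; have /eqaddoP/(_ e e0) := funext ds.
by rewrite lim_id //; apply: filterS => x; rewrite /= !fctE opprD addrA.
Qed.

(** The quotients [q k] converge, so they are eventually bounded by [|v| + 1], and the remainder of
    [s] at [x k], divided by [t k], is at most an arbitrarily small multiple of [|q k|]. *)
Lemma cvg_diff_quotient (R : realType) (V W : normedModType R) (s : V -> W)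
    (x0 v : V) (x : nat -> V) (t : nat -> R) :
  differentiable s x0 -> (forall k, 0 < t k) ->
  t @ \oo --> 0 -> (t k)^-1 *: (x k - x0) @[k --> \oo] --> v ->
  x @ \oo --> x0 /\ (t k)^-1 *: (s (x k) - s x0) @[k --> \oo] --> 'd s x0 v.
Proof.
move=> ds t0 tc xv; pose q k := (t k)^-1 *: (x k - x0).
have xq k : x k - x0 = t k *: q k by rewrite scalerA mulfV ?gt_eqF// scale1r.
have xx0 : x @ \oo --> x0.
  have -> : x = (fun k => t k *: q k + x0).
    by apply/funext => k; rewrite -xq subrK.
  rewrite -[X in _ --> X]add0r -[X in X + _](scale0r v).
  by apply: cvgD; [exact: cvgZ|exact: cvg_cst].
split=> //; pose r k := (t k)^-1 *: (s (x k) - s x0) - 'd s x0 (q k).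
have -> : (fun k => (t k)^-1 *: (s (x k) - s x0))
    = (fun k => 'd s x0 (q k) + r k).
  by apply/funext => k; rewrite /r [RHS]addrC subrK.
rewrite -[X in _ --> X]addr0; apply: cvgD.
  have dc : {for v, continuous ('d s x0)} by exact: diff_continuous.
  exact: (cvg_comp _ _ xv dc).
apply/cvgrPdist_le => e e0.
have v0 : 0 < `|v| + 1 by rewrite ltr_wpDl.
have ev0 : 0 < e / (`|v| + 1) by rewrite divr_gt0.
have rs := xx0 _ (diff_remainder ds ev0).
have qb : \forall k \near \oo, `|q k| <= `|v| + 1.
  have /cvgrPdist_le/(_ 1 ltr01) := xv; apply: filterS => k vq.
  rewrite -[q k](subrK v) addrC (le_trans (ler_normD _ _))// lerD2l.
  by rewrite distrC.
near=> k; rewrite sub0r normrN.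
have -> : r k = (t k)^-1 *: (s (x k) - s x0 - 'd s x0 (x k - x0)).
  by rewrite /r /q linearZ [RHS]scalerBr.
rewrite normrZ gtr0_norm ?invr_gt0// ler_pdivrMl//.
have rk : `|s (x k) - s x0 - 'd s x0 (x k - x0)|
    <= e / (`|v| + 1) * `|x k - x0| by near: k.
apply: le_trans rk _; rewrite xq normrZ gtr0_norm// mulrCA.
rewrite ler_wpM2l ?(ltW (t0 k))//.
by rewrite mulrAC ler_pdivrMr// ler_wpM2l ?(ltW e0)//; near: k.
Unshelve. all: by end_near. Qed.

Lemma diff_coord (R : realType) (n q : nat) (f : 'rV[R]_n -> 'rV[R]_q)
    (x v : 'rV[R]_n) (j : 'I_q) :
  differentiable f x -> 'd (fun y => f y 0 j) x v = (v *m 'J f x) 0 j.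
Proof.
move=> df; rewrite -deriveEjacobian// derive_mx ?mxE ?deriveE//.
  exact: (differentiable_comp df (differentiable_coord _ _ _)).
exact: diff_derivable.
Qed.

(** * Tangent vectors read in a chart *)

Lemma open_coords_image (R : realType) (n : nat) (M : topologicalType)
    (c : chart R n M) (O : set M) :
  open O -> open (coords c @` (dom c `&` O)).
Proof.
move=> oO; rewrite openE => _ [x [cx Ox] <-].
have cy : cod c (coords c x) by exact: coords_cod.
have nO : nbhs (param c (coords c x)) O.
  by rewrite coordsK//; exact: open_nbhs_nbhs.
have := param_continuous cy nO.
have := open_nbhs_nbhs (conj (@open_cod _ _ _ c) cy).
apply: filterS2 => y yc yO; exists (param c y); last exact: paramK.
by split=> //; exact: param_dom.
Qed.

Lemma differentiable_param (R : realType) (n : nat) (M : smooth_manifold R n)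
    (c : chart R n M) (p : M) (s : C1_near p) :
  atlas c -> dom c p -> differentiable (s \o param c) (coords c p).
Proof.
move=> ac cp; have [U [_ Up] sC] := C1_nearP s; have [ds _] := sC c ac.
by apply: ds; exists p.
Qed.

(** The vector [v] is the coordinate velocity of a generating curve. Near time 0 the curve stays in
    [dom c], so [s \o gamma] factors through the chart and the chain rule applies. *)
Lemma tangent_in_chart (R : realType) (n : nat) (M : smooth_manifold R n)
    (c : chart R n M) (p : M) (xi : tangent p) :
  atlas c -> dom c p ->
  exists v, forall s, xi s = 'd (s \o param c) (coords c p) v.
Proof.
move=> ac cp; have [e [gamma [e0 [gc gC] g0 xiE]]] := tangentP xi; rewrite xiE.
have [dg _] := gC c ac.
have e00 : - e < 0 < e by rewrite oppr_lt0 e0.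
have dphi : differentiable (coords c \o gamma) (0 : R).
  by apply: dg; split; rewrite /= ?g0.
exists ('d (coords c \o gamma) (0 : R) 1) => s.
have ds := differentiable_param s ac cp.
rewrite /velocity derive1E.
rewrite (@near_eq_derive _ _ _ _ ((s \o param c) \o (coords c \o gamma))).
  have ds0 : differentiable (s \o param c) ((coords c \o gamma) (0 : R)).
    by rewrite /comp g0.
  rewrite (deriveE _ (differentiable_comp dphi ds0)) (diff_comp dphi ds0).
  by rewrite [in LHS]/comp g0.
have nd : nbhs (gamma 0) (dom c).
  by rewrite g0; apply: open_nbhs_nbhs; split=> //; exact: open_dom.
have nt : \forall t \near (0 : R), dom c (gamma t) by exact: (gc 0 e00 _ nd).
by near=> t; rewrite /= coordsK//; near: t.
Unshelve. all: by end_near. Qed.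

(** * The main inclusion in coordinates *)

(** The columns of ['J H x0] are the differentials of the equality constraints, so the hypothesis on
    [a] is their independence; [v0] is the MFCQ direction and [v] the linearized one. *)
Lemma mfcq_tangent_dir (R : realType) (n m q : nat) (A : set 'rV[R]_n)
    (G : 'rV[R]_n -> 'rV[R]_m) (H : 'rV[R]_n -> 'rV[R]_q)
    (x0 v v0 : 'rV[R]_n) :
  open A -> A x0 -> differentiable G x0 -> Ck 1 A H ->
  (forall i, G x0 0 i <= 0) -> H x0 = 0 ->
  (forall a : 'cV_q, 'J H x0 *m a = 0 -> a = 0) ->
  (forall i, G x0 0 i = 0 -> (v0 *m 'J G x0) 0 i < 0) -> v0 *m 'J H x0 = 0 ->
  (forall i, G x0 0 i = 0 -> (v *m 'J G x0) 0 i <= 0) -> v *m 'J H x0 = 0 ->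
  tangent_dir [set x | (forall i, G x 0 i <= 0) /\ H x = 0] x0 v.
Proof.
move=> oA Ax0 dG HA Gx0 Hx0 /left_inverse_mx[B BJ] v0G v0H vG vH.
apply: tangent_dir_closed => e e0.
have v00 : 0 < `|v0| + 1 by rewrite ltr_wpDl.
pose s := e / (`|v0| + 1); have s0 : 0 < s by rewrite divr_gt0.
pose w := v + s *: v0; exists w.
  rewrite /w addrC addKr normrZ gtr0_norm// /s mulrAC ler_pdivrMr//.
  by rewrite ler_wpM2l ?(ltW e0)// lerDl.
have wH : w *m 'J H x0 = 0 by rewrite mulmxDl vH -scalemxAl v0H scaler0 addr0.
have wG i : G x0 0 i = 0 -> (w *m 'J G x0) 0 i < 0.
  move=> Gi; rewrite mulmxDl -scalemxAl mxE [X in _ + X]mxE.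
  by rewrite -[ltRHS]addr0 ler_ltD ?vG// pmulr_rlt0// v0G.
have : tangent_dir [set x | H x = 0] x0 w.
  move=> r r0; have [d d0 Hd] := lyusternik oA HA Ax0 Hx0 BJ wH r0.
  have dr0 : 0 < Num.min d r by rewrite lt_min d0.
  have t0 : 0 < Num.min d r / 2 by rewrite divr_gt0.
  have tdr : Num.min d r / 2 < Num.min d r by lra.
  have /andP[td tr] : (Num.min d r / 2 < d) && (Num.min d r / 2 < r).
    by rewrite -lt_min.
  have [|x Hx xw] := Hd (Num.min d r / 2); first by rewrite t0.
  by exists (Num.min d r / 2), x; rewrite t0.
move=> /tangent_dir_seq[x [t [Hx t0 _ tc xc]]] r r0.
have [xx0 _] := cvg_diff_quotient dG t0 tc xc.
(* For active [i] the quotients tend to a negative limit and [G x0 0 i = 0]; for inactive [i]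
   continuity suffices. Finitely many indices admit a common threshold. *)
have nG : \forall k \near \oo, forall i, G (x k) 0 i <= 0.
  apply: (@filter_forall _ _ (fun i k => G (x k) 0 i <= 0)) => i.
  have dGi : differentiable (fun y => G y 0 i) x0.
    exact: (differentiable_comp dG (differentiable_coord _ _ _)).
  have [Gi0|Gi0] := eqVneq (G x0 0 i) 0.
    have [_] := cvg_diff_quotient dGi t0 tc xc.
    rewrite diff_coord// => /cvgr_le/(_ _ (wG i Gi0)); apply: filterS => k.
    by rewrite Gi0 subr0 pmulr_rle0 // invr_gt0.
  have Gi0' : G x0 0 i < 0 by rewrite lt_neqAle Gi0 Gx0.
  have cGi : {for x0, continuous (fun y => G y 0 i)}.
    exact: differentiable_continuous.
  by have /cvgr_le/(_ _ Gi0') := cvg_comp _ _ xx0 cGi; apply: filterS.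
have nt : \forall k \near \oo, t k < r by exact: (cvgr_lt _ tc).
have nw : \forall k \near \oo, `|x k - x0 - t k *: w| <= t k * r.
  have /cvgrPdist_le/(_ r r0) := xc; apply: filterS => k xk.
  have -> : x k - x0 - t k *: w = - (t k *: (w - (t k)^-1 *: (x k - x0))).
    by rewrite scalerBr scalerA mulfV ?gt_eqF// scale1r opprB.
  by rewrite normrN normrZ gtr0_norm// ler_wpM2l// ltW.
near \oo => k; exists (t k), (x k); split.
- by rewrite t0; near: k.
- by split; [near: k|exact: Hx].
- by near: k.
Unshelve. all: by end_near. Qed.

(** * Transfer to the manifold *)

Theorem proposition3p17 (R : realType) (n m q : nat) (M : smooth_manifold R n)
    (g : C1_map M 'rV[R]_m) (h : C1_map M 'rV[R]_q) (p : M)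
    (hp : feasible_set g h p) (hMFCQ : MFCQ g h p) :
  ACQ g h p.
Proof.
have [gp0 hp0] := hp; apply/seteqP; split; last first.
  move=> xi [pk [t [Opk _ [t0 _] _ xis]]]; split=> [i ai|j].
    apply: (cvgr_to_le (xis (comp_near g i p))); apply: nearW => k.
    rewrite /= ai subr0 pmulr_lle0 ?invr_gt0//.
    by have [gpk _] := Opk k.
  have hk k : (comp_near h j p (pk k) - comp_near h j p p) / t k = 0.
    by have [_ hpk] := Opk k; rewrite /= hpk hp0 subrr mul0r.
  have := xis (comp_near h j p); under eq_fun do rewrite hk.
  by move=> xi_h; apply: norm_cvg_unique xi_h _; exact: cvg_cst.
move=> xi [xig xih]; have [hind [xi0 [xi0g xi0h]]] := hMFCQ.
have [c ac cp] := atlas_cover p; set x0 := coords c p.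
pose A := coords c @` (dom c `&` [set: M]).
have oA : open A by apply: open_coords_image; exact: openT.
have Ax0 : A x0 by exists p.
pose G := g \o param c; pose H := h \o param c.
have HA : Ck 1 A H by exact: (C1_mapP h ac).
have dG : differentiable G x0 by have [+ _] := C1_mapP g ac; exact.
have dH : differentiable H x0 by have [+ _] := HA; exact.
have pc : param c x0 = p by exact: coordsK.
have gE (ze : tangent p) z i :
    (forall s, ze s = 'd (s \o param c) x0 z) ->
    ze (comp_near g i p) = (z *m 'J G x0) 0 i.
  by move=> ->; rewrite -diff_coord.
have hE (ze : tangent p) z j :
    (forall s, ze s = 'd (s \o param c) x0 z) ->
    ze (comp_near h j p) = (z *m 'J H x0) 0 j.
  by move=> ->; rewrite -diff_coord.
have [v vE] := tangent_in_chart xi ac cp.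
have [v0 v0E] := tangent_in_chart xi0 ac cp.
have /tangent_dir_seq[x [t [Px t0 tni tc xc]]] :
    tangent_dir [set x | (forall i, G x 0 i <= 0) /\ H x = 0] x0 v.
  apply: (mfcq_tangent_dir (v0 := v0) oA Ax0 dG HA).
  - by move=> i; rewrite /G /= pc.
  - by rewrite /H /= pc.
  (* Multiplying ['J H x0 *m a = 0] on the left by the coordinates [z] of any tangent vector [ze]
     gives a vanishing combination of the differentials at [ze]; independence then applies. *)
  - move=> a Ja; apply/matrixP => j k; rewrite [k]ord1 [RHS]mxE.
    move: j; apply: hind; apply/funext => ze.
    have [z zE] := tangent_in_chart ze ac cp.
    have := congr1 (fun b : 'cV_n => (z *m b) 0 0) Ja.
    rewrite mulmx0 mulmxA [LHS]mxE [RHS]mxE => Jza.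
    rewrite fct_sumE -[RHS]Jza; apply: eq_bigr => j _.
    by rewrite -(hE ze z j zE) mulrC.
  - move=> i; rewrite /G /= pc => gi; rewrite -(gE _ _ i v0E).
    exact: xi0g.
  - by apply/rowP => j; rewrite -(hE _ _ j v0E) mxE; exact: xi0h.
  - move=> i; rewrite /G /= pc => gi; rewrite -(gE _ _ i vE).
    exact: xig.
  - by apply/rowP => j; rewrite -(hE _ _ j vE) mxE.
(* Since [G] and [H] are compositions with the total map [param c], these points are feasible for
   every [k], even if some [x k] lies outside [cod c]. *)
exists (param c \o x), t; split.
- by move=> k; have [Gk Hk] := Px k; split.
- have [xx0 _] := cvg_diff_quotient dG t0 tc xc.
  have cx0 : cod c x0 by exact: coords_cod.
  by have := cvg_comp _ _ xx0 (param_continuous cx0); rewrite pc.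
- by split.
- exact: tc.
- move=> s; have ds := differentiable_param s ac cp.
  have [_] := cvg_diff_quotient ds t0 tc xc; rewrite -vE /= pc.
  by under eq_fun do rewrite [_ *: _]mulrC.
Qed.
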